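(* Let $0<q<1$. The Mallows measure $\mathcal Q$ with parameter $q$ on the group $\mathfrak S^{\mathrm{bal}}$ of balanced permutations of $\mathbb Z$ is invariant under the inversion map $\sigma\mapsto\sigma^{-1}$.
   Context: $\mathfrak S$ is the group of all bijections of $\mathbb Z$, with the topology of pointwise convergence (for each $i$, $\sigma_n(i)=\sigma(i)$ for all large $n$) and its Borel structure. $\sigma\in\mathfrak S$ is balanced if $\#\{j\ge 1:\sigma(j)\le 0\}=\#\{j\le 0:\sigma(j)\ge 1\}<\infty$; $\mathfrak S^{\mathrm{bal}}$ is the group of balanced permutations. For $i\in\mathbb Z$ let $\sigma_{i,i+1}$ be the transposition swapping $i$ and $i+1$. A measure $\mu$ is right $q$-exchangeable if for every $i\in\mathbb Z$ its pushforward under $\sigma\mapsto\sigma\sigma_{i,i+1}$ is equivalent to $\mu$ with Radon–Nikodým derivative $q^{\mathrm{sgn}(\sigma(i+1)-\sigma(i))}$ at $\sigma$; it is left $q$-exchangeable if for every $i$ its pushforward under $\sigma\mapsto\sigma_{i,i+1}\sigma$ is equivalent to $\mu$ with derivative $q^{\mathrm{sgn}(\sigma^{-1}(i+1)-\sigma^{-1}(i))}$. The Mallows measure $\mathcal Q$ is the unique (existing) Borel probability measure on $\mathfrak S^{\mathrm{bal}}$ that is both right and left $q$-exchangeable. *)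

(* Defs.v *)
From HB Require Import structures.
From mathcomp Require Import all_boot all_order all_algebra.
From mathcomp Require Import finmap zify.
From mathcomp Require Import all_classical all_reals all_analysis.

Set Implicit Arguments.
Unset Strict Implicit.
Unset Printing Implicit Defensive.

Import Order.TTheory GRing.Theory Num.Theory.

Local Open Scope classical_set_scope.
Local Open Scope ring_scope.

(* [permZ] carries the subspace topology inherited from the product topology
   on Z^Z, each factor being discrete; this is the topology of pointwise
   convergence. *)
Definition permZ : Type := set_type
  [set f : prod_topology (fun _ : int => discrete_topology int) | bijective f].

HB.instance Definition _ := Topological.copy permZ (set_type
  [set f : prod_topology (fun _ : int => discrete_topology int) | bijective f]).

Definition fun_of_permZ (s : permZ) : int -> int := sval s.
Coercion fun_of_permZ : permZ >-> Funclass.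

Lemma permZ_bij (s : permZ) : bijective s.
Proof. by case: s => f /= /set_mem. Qed.

Lemma permZP (s t : permZ) : (s : int -> int) =1 t -> s = t.
Proof. by move=> /funext st; apply: val_inj. Qed.

Definition PermZ (f : int -> int) (fbij : bijective f) : permZ :=
  exist _ (f : prod_topology (fun _ : int => discrete_topology int))
    (mem_set fbij).

Definition permZ_inv_fun (s : permZ) (j : int) : int := xget 0 [set i | s i = j].

Lemma permZ_invK (s : permZ) : cancel (permZ_inv_fun s) s.
Proof.
move=> j; have [g _ gK] := permZ_bij s; rewrite /permZ_inv_fun.
by case: xgetP => [i _ //|/(_ (g j))] /=; rewrite gK.
Qed.

Lemma permZK (s : permZ) : cancel s (permZ_inv_fun s).
Proof. by move=> i; apply: (bij_inj (permZ_bij s)); rewrite permZ_invK. Qed.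

Lemma permZ_inv_bij (s : permZ) : bijective (permZ_inv_fun s).
Proof. exact: Bijective (@permZ_invK s) (@permZK s). Qed.

Definition permZ_one : permZ := PermZ (Bijective (frefl id) (frefl id)).
Definition permZ_inv (s : permZ) : permZ := PermZ (permZ_inv_bij s).
Definition permZ_mul (s t : permZ) : permZ :=
  PermZ (bij_comp (permZ_bij s) (permZ_bij t)).

Fact permZ_mulA : associative permZ_mul.
Proof. by move=> s t u; apply: permZP. Qed.
Fact permZ_mul1 : left_id permZ_one permZ_mul.
Proof. by move=> s; apply: permZP. Qed.
Fact permZ_mulr1 : right_id permZ_one permZ_mul.
Proof. by move=> s; apply: permZP. Qed.
Fact permZ_mulV : left_inverse permZ_one permZ_inv permZ_mul.
Proof. by move=> s; apply: permZP => i; exact: permZK. Qed.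
Fact permZ_mulrV : right_inverse permZ_one permZ_inv permZ_mul.
Proof. by move=> s; apply: permZP => i; exact: permZ_invK. Qed.

(* [s * t] maps [i] to [s (t i)]. *)
HB.instance Definition _ := isGroup.Build permZ
  permZ_mulA permZ_mul1 permZ_mulr1 permZ_mulV permZ_mulrV.

Lemma permZ_mulE (s t : permZ) i : (s * t : permZ)%g i = s (t i).
Proof. by []. Qed.

Lemma permZ_invE (s : permZ) i j : (s^-1 : permZ)%g j = i <-> s i = j.
Proof. by split=> <-; [exact: permZ_invK|exact: permZK]. Qed.

Definition balanced (s : permZ) : Prop :=
  finite_set [set j | 1 <= j /\ s j <= 0] /\
  ([set j | 1 <= j /\ s j <= 0] #= [set j | j <= 0 /\ 1 <= s j])%card.

Lemma balanced1 : balanced 1%g.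
Proof.
rewrite /balanced.
have -> : [set j | 1 <= j /\ (1%g : permZ) j <= 0] = set0.
  by apply/seteqP; split=> j //= -[j1 /(le_trans j1)].
have -> : [set j | j <= 0 /\ 1 <= (1%g : permZ) j] = set0.
  by apply/seteqP; split=> j //= -[j0 j1]; have := le_trans j1 j0.
by split; [exact: finite_set0|exact: card_eqxx].
Qed.

Lemma balancedV (s : permZ) : balanced s -> balanced s^-1%g.
Proof.
move=> [finA AB]; rewrite /balanced.
have sI : injective s := bij_inj (permZ_bij s).
have sV j : s ((s^-1%g : permZ) j) = j by exact: permZ_invK.
have Vs j : (s^-1%g : permZ) (s j) = j by exact: permZK.
have -> : [set j | 1 <= j /\ (s^-1%g : permZ) j <= 0]
    = s @` [set j | j <= 0 /\ 1 <= s j].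
  apply/seteqP; split=> j /= => [[j1 j0]|[i [i0 i1] <-]];
    last by have := Vs i; rewrite /= => ->.
  by exists ((s^-1%g : permZ) j); rewrite ?sV.
have -> : [set j | j <= 0 /\ 1 <= (s^-1%g : permZ) j]
    = s @` [set j | 1 <= j /\ s j <= 0].
  apply/seteqP; split=> j /= => [[j1 j0]|[i [i0 i1] <-]];
    last by have := Vs i; rewrite /= => ->.
  by exists ((s^-1%g : permZ) j); rewrite ?sV.
split; first by apply: finite_image; rewrite -(eq_finite_set AB).
have imE (X : set int) : (s @` X #= X)%card.
  by apply: inj_card_eq => x y _ _; exact: sI.
by rewrite (card_eql (imE _)) (card_eqr (imE _)) card_eq_sym.
Qed.

Definition cnt (X : set int) : nat := #|` fset_set X|.

Lemma cnt_split (X Y : set int) : finite_set X ->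
  cnt X = (cnt (X `&` Y) + cnt (X `&` ~` Y))%N.
Proof.
move=> finX; have finXY : finite_set (X `&` Y) by exact: finite_setIl.
have -> : X `&` ~` Y = X `\` (X `&` Y) by rewrite setDIr setDv set0U setDE.
rewrite /cnt fset_setD// -[LHS](cardfsID (fset_set (X `&` Y))).
congr (#|` _| + _)%N; rewrite -fset_setI//; congr fset_set.
by rewrite setIA setIid.
Qed.

Lemma balancedM (s t : permZ) : balanced s -> balanced t -> balanced (s * t)%g.
Proof.
move=> [finAs ABs] [finAt ABt].
pose P := [set j : int | 1 <= j].
pose T := [set j | 1 <= t j]; pose U := [set j | 1 <= s (t j)].
have tI : injective t := bij_inj (permZ_bij t).
have pre (X : set int) : (t @^-1` X #= X)%card.
  rewrite -[in X in (_ #= X)%card](@image_preimage _ _ t X).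
    by rewrite card_eq_sym; apply: inj_card_eq => x y _ _; exact: tI.
  apply/seteqP; split=> // j _; exists ((t^-1%g : permZ) j) => //.
  exact: permZ_invK.
have eAs : t @^-1` [set j | 1 <= j /\ s j <= 0] = T `&` ~` U.
  by apply/seteqP; split=> j /=; rewrite /T /U /= => -[? ?]; split; lia.
have eBs : t @^-1` [set j | j <= 0 /\ 1 <= s j] = ~` T `&` U.
  by apply/seteqP; split=> j /=; rewrite /T /U /= => -[? ?]; split; lia.
have eAt : [set j | 1 <= j /\ t j <= 0] = P `&` ~` T.
  by apply/seteqP; split=> j /=; rewrite /T /P /= => -[? ?]; split; lia.
have eBt : [set j | j <= 0 /\ 1 <= t j] = ~` P `&` T.
  by apply/seteqP; split=> j /=; rewrite /T /P /= => -[? ?]; split; lia.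
have eA : [set j | 1 <= j /\ s (t j) <= 0] = P `&` ~` U.
  by apply/seteqP; split=> j /=; rewrite /U /P /= => -[? ?]; split; lia.
have eB : [set j | j <= 0 /\ 1 <= s (t j)] = ~` P `&` U.
  by apply/seteqP; split=> j /=; rewrite /U /P /= => -[? ?]; split; lia.
have {}ABs : (T `&` ~` U #= ~` T `&` U)%card.
  by rewrite -eAs -eBs (card_eql (pre _)) (card_eqr (pre _)).
have {}finAs : finite_set (T `&` ~` U) by rewrite -eAs (eq_finite_set (pre _)).
rewrite eAt eBt in ABt; rewrite eAt in finAt.
have finBs : finite_set (~` T `&` U) by rewrite -(eq_finite_set ABs).
have finBt : finite_set (~` P `&` T) by rewrite -(eq_finite_set ABt).
change (finite_set [set j | 1 <= j /\ s (t j) <= 0] /\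
  ([set j | 1 <= j /\ s (t j) <= 0] #= [set j | j <= 0 /\ 1 <= s (t j)])%card).
rewrite eA eB.
have finA : finite_set (P `&` ~` U).
  apply: (@sub_finite_set _ _ ((P `&` ~` T) `|` (T `&` ~` U))).
    move=> j [Pj Uj]; have [Tj|Tj] := pselect (T j); first by right.
    by left.
  by rewrite finite_setU.
have finB : finite_set (~` P `&` U).
  apply: (@sub_finite_set _ _ ((~` P `&` T) `|` (~` T `&` U))).
    move=> j [Pj Uj]; have [Tj|Tj] := pselect (T j); first by left.
    by right.
  by rewrite finite_setU.
split=> //; apply/fcard_eq => //.
move/fcard_eq : ABs => /(_ finAs finBs); move/fcard_eq : ABt => /(_ finAt finBt).
rewrite -!/(cnt _) (cnt_split U finAt) (cnt_split U finBt).
rewrite (cnt_split P finAs) (cnt_split P finBs).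
rewrite (cnt_split T finA) (cnt_split T finB).
have -> : P `&` ~` T `&` U = ~` T `&` U `&` P.
  by apply/seteqP; split=> j /=; tauto.
have -> : P `&` ~` T `&` ~` U = P `&` ~` U `&` ~` T.
  by apply/seteqP; split=> j /=; tauto.
have -> : ~` P `&` T `&` U = ~` P `&` U `&` T.
  by apply/seteqP; split=> j /=; tauto.
have -> : ~` P `&` T `&` ~` U = T `&` ~` U `&` ~` P.
  by apply/seteqP; split=> j /=; tauto.
have -> : T `&` ~` U `&` P = P `&` ~` U `&` T.
  by apply/seteqP; split=> j /=; tauto.
have -> : ~` T `&` U `&` ~` P = ~` P `&` U `&` ~` T.
  by apply/seteqP; split=> j /=; tauto.
by lia.
Qed.

(* [balperm] is the subgroup of balanced permutations with the subspace
   topology. *)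
Definition balperm : Type := set_type [set s : permZ | balanced s].

HB.instance Definition _ := Topological.copy balperm
  (set_type [set s : permZ | balanced s]).
HB.instance Definition _ := SubChoice.copy balperm
  (set_type [set s : permZ | balanced s]).

Fact balanced_group_closed :
  group_closed (fun s : permZ => s \in [set s | balanced s]).
Proof.
split; first by apply/mem_set; exact: balanced1.
move=> s t /set_mem sb /set_mem tb; apply/mem_set.
by apply: balancedM => //; exact: balancedV.
Qed.

HB.instance Definition _ :=
  SubChoice_isSubGroup.Build permZ _ balperm balanced_group_closed.
HB.instance Definition _ := isPointed.Build balperm 1%g.

HB.instance Definition _ :=
  Measurable.copy balperm (g_sigma_algebraType (@open balperm)).

Definition permZ_of_balperm (s : balperm) : permZ := val s.
Coercion permZ_of_balperm : balperm >-> permZ.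

Definition adj_fun (i j : int) : int :=
  if j == i then i + 1 else if j == i + 1 then i else j.

Lemma adj_funK (i : int) : involutive (adj_fun i).
Proof.
move=> j; rewrite /adj_fun; have [->|ji] := eqVneq j i.
  by rewrite eqxx; case: eqP => //; lia.
have [->|ji1] := eqVneq j (i + 1); first by rewrite eqxx.
by rewrite (negbTE ji) (negbTE ji1).
Qed.

Definition adj_permZ (i : int) : permZ :=
  PermZ (Bijective (adj_funK i) (adj_funK i)).

Lemma balanced_adj (i : int) : balanced (adj_permZ i).
Proof.
have eB : [set j | j <= 0 /\ 1 <= adj_permZ i j]
    = adj_permZ i @` [set j | 1 <= j /\ adj_permZ i j <= 0].
  apply/seteqP; split=> j /= => [[j0 j1]|[k [k0 k1] <-]].
    by exists (adj_fun i j); rewrite /= ?adj_funK.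
  by rewrite /= adj_funK.
rewrite /balanced eB; split.
  apply: (@sub_finite_set _ _ [set i; i + 1]); last exact: finite_set2.
  move=> j /=; rewrite /fun_of_permZ /= /adj_fun /=.
  by case: eqP => [->|_]; [left|case: eqP => [->|_]; [right|lia]].
rewrite card_eq_sym; apply: inj_card_eq => x y _ _.
exact: (bij_inj (permZ_bij (adj_permZ i))).
Qed.

Definition adj (i : int) : balperm :=
  exist _ (adj_permZ i) (mem_set (balanced_adj i)).

Section exchangeability.
Context {R : realType}.
Implicit Types (q : R) (mu : {measure set balperm -> \bar R}).

(* [nu] is equivalent to [mu], with Radon-Nikodym derivative d[nu]/d[mu] = [f].
   It is a bare set function so that it can be a [pushforward]. *)
Definition equivalent_density (nu : set balperm -> \bar R) mu (f : balperm -> R) : Prop :=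
  [/\ nu `<< mu, mu `<< nu, measurable_fun [set: balperm] f &
     forall A : set balperm, measurable A ->
       nu A = (\int[mu]_(s in A) (f s)%:E)%E].

Definition right_exchangeable q mu : Prop := forall i : int,
  equivalent_density (pushforward mu (fun s : balperm => (s * adj i)%g)) mu
    (fun s => q ^ sgz (s (i + 1) - s i)).

Definition left_exchangeable q mu : Prop := forall i : int,
  equivalent_density (pushforward mu (fun s : balperm => (adj i * s)%g)) mu
    (fun s => q ^ sgz ((s^-1%g : balperm) (i + 1) - (s^-1%g : balperm) i)).

(* Exactly one probability measure satisfies this predicate when 0 < q < 1; as
   neither existence nor uniqueness is built in, a result on "the" Mallows
   measure is stated for every [Q] such that [mallows q Q]. *)
Definition mallows q (Q : probability balperm R) : Prop :=
  right_exchangeable q Q /\ left_exchangeable q Q.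

End exchangeability.

(* Main.v *)
Require Import Defs.
From HB Require Import structures.
From mathcomp Require Import all_boot all_order all_algebra all_fingroup.
From mathcomp Require Import finmap zify.
From mathcomp Require Import all_classical all_reals all_analysis.

(** Inversion exchanges left and right multiplication, so it carries the left
    [q]-exchangeable measure [Q] to a right [q]-exchangeable one. As [Q] is
    itself right [q]-exchangeable, the theorem follows from the uniqueness of a
    right [q]-exchangeable probability measure on the balanced permutations,
    [ascent_scaling_unique].

    Uniqueness has two ingredients. First, the law of the relative order of
    [s (-n), ..., s (n - 1)] is forced. Encode this relative order as a
    permutation [rank n s] of [2n] points; right multiplication of [s] by an
    adjacent transposition of the window multiplies [rank n s] by the same
    transposition ([rank_adj]), so exchangeability fixes the ratio of the
    probabilities of two patterns which differ by an adjacent transposition.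
    Such transpositions connect all patterns ([perm_adjacent_ind]), and the
    probabilities add up to 1, hence any two candidates agree
    ([mallows_weight_unique]).

    Second, the relative orders on all windows determine a balanced [s]: if [n]
    is large, then balancedness makes the number of [k] in the window with
    [s k < m] equal to [m + n] ([below_eventually]), and for [m := s i] that
    number is the rank of position [i]. Hence the events which depend only on
    the relative order in some window generate the Borel sigma-algebra
    ([measurable_order_events]). They are stable under intersection, so two
    probability measures which agree on them are equal. *)

Set Implicit Arguments.
Unset Strict Implicit.
Unset Printing Implicit Defensive.

Import Order.TTheory GRing.Theory Num.Theory.

Local Open Scope classical_set_scope.
Local Open Scope ring_scope.

(** * Pointwise convergence and finite windows *)

Definition in_window (n : nat) (k : int) := (- n%:Z <= k) && (k < n%:Z).

Definition agree (n : nat) (f g : int -> int) :=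
  forall k, in_window n k -> f k = g k.

Lemma in_window_le m n k : (m <= n)%N -> in_window m k -> in_window n k.
Proof. by rewrite /in_window; lia. Qed.

Lemma eval_nbhs (s : balperm) k : nbhs s [set t : balperm | t k = s k].
Proof.
pose T := prod_topology (fun _ : int => discrete_topology int).
have c1 : continuous (val : balperm -> permZ) by exact: initial_continuous.
have c2 : continuous (sval : permZ -> T).
  exact: (@initial_continuous permZ T sval).
have c3 := @proj_continuous int (fun _ => discrete_topology int) k.
have c23 := @continuous_comp permZ T _ sval (proj k) (val s) (c2 (val s)) (c3 _).
have /(_ [set s k]) := @continuous_comp balperm permZ _ val
  (proj k \o (sval : permZ -> T)) s (c1 s) c23.
by apply; exact: discrete_set1.
Qed.

(** Together with [nbhs_agree]: the permutations that coincide with [s] on a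
    window form a neighbourhood basis of [s]. *)
Lemma agree_nbhs (s : balperm) n : nbhs s [set t : balperm | agree n s t].
Proof.
have : \forall t \near s, forall j : 'I_n.*2,
    (t : balperm) (j%:Z - n%:Z) = s (j%:Z - n%:Z).
  by apply: (@filter_forall _ _ (fun (j : 'I_n.*2) (t : balperm) =>
    t (j%:Z - n%:Z) = s (j%:Z - n%:Z)) (nbhs s)) => j; exact: eval_nbhs.
apply: filterS => t st k kn.
have jn : (absz (k + n%:Z)%R < n.*2)%N by move: kn; rewrite /in_window; lia.
have /= := st (Ordinal jn).
by rewrite (_ : (absz (k + n%:Z))%:Z - n%:Z = k)//; move: kn; rewrite /in_window; lia.
Qed.

Lemma nbhs_agree (s : balperm) U : nbhs s U ->
  exists n, [set t : balperm | agree n s t] `<=` U.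
Proof.
case=> _ [[_ [D oD <-] <-] /= Ds DU].
pose T := prod_topology (fun _ : int => discrete_topology int).
(* The windows generate a filter of functions that converges to [s], because it
   does so in every coordinate. *)
pose F : set_system T := filter_from setT (fun n => [set f : T | agree n s f]).
have FF : Filter F.
  apply: filter_from_filter; first by exists 0%N.
  move=> i j _ _; exists (maxn i j) => // f sf; split=> k kw; apply: sf;
    by apply: in_window_le kw; lia.
have Fs : F --> (s : T).
  apply/cvg_sup => i V [_ [[W oW <-] Ws WV]].
  exists `|i|%N.+1 => // f sf; apply: WV => /=.
  by rewrite -sf//; rewrite /in_window; lia.
have [|n _ nD] := Fs D; first exact: open_nbhs_nbhs.
by exists n => t st; apply: DU; exact: nD.
Qed.

Lemma determined_open n (A : set balperm) :
  (forall s t : balperm, agree n s t -> A s -> A t) -> open A.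
Proof.
move=> An; rewrite openE => s As; rewrite /interior.
by apply: filterS (agree_nbhs s n) => t st; exact: An As.
Qed.

Lemma measurable_balperm_open (A : set balperm) : open A -> measurable A.
Proof. exact: sub_sigma_algebra. Qed.

Lemma balperm_invE (s : balperm) j k : (s^-1 : balperm)%g j = k <-> s k = j.
Proof. exact: permZ_invE. Qed.

(** The values of [s^-1] on a window depend on [s] only through the finitely
    many points which [s] maps into that window. *)
Lemma inv_continuous : continuous (fun s : balperm => s^-1%g).
Proof.
move=> s U /nbhs_agree[n nU].
have [m mn] : exists m : nat, forall j : 'I_n.*2,
    in_window m ((s^-1%g : balperm) (j%:Z - n%:Z)).
  exists (\max_(j < n.*2) absz ((s^-1%g : balperm) (j%:Z - n%:Z)%R))%N.+1 => j.
  have := @leq_bigmax _ (fun j : 'I_n.*2 => absz ((s^-1%g : balperm) (j%:Z - n%:Z))) j.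
  rewrite /in_window; move: (\max_(_ < _) _)%N ((s^-1%g : balperm) _) => M x; lia.
apply: filterS (agree_nbhs s m) => t st; apply: nU => k kn.
have jn : (absz (k + n%:Z)%R < n.*2)%N by move: kn; rewrite /in_window; lia.
have := mn (Ordinal jn).
rewrite (_ : _ - _ = k); last by move: kn; rewrite /in_window /=; lia.
by move/st => e; apply/esym/balperm_invE; rewrite -e; exact/balperm_invE.
Qed.

(** * Functions on a finite symmetric group determined by adjacent swaps *)

(** Adjacent transpositions generate the symmetric group: a transposition of
    points at distance [k + 1] is conjugate, under an adjacent one, to a
    transposition of points at distance [k]. *)
Lemma perm_adjacent_ind m (P : 'S_m -> Prop) :
  P 1%g ->
  (forall (i j : 'I_m) p, j = i.+1 :> nat -> P p -> P (tperm i j * p)%g) ->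
  forall p, P p.
Proof.
move=> P1 Padj p.
(* The elements whose left multiplication preserves [P] form a subgroup. *)
pose H := [set h : 'S_m | `[< forall p, P p -> P (h * p)%g >]]%SET.
have HP h : h \in H <-> forall p, P p -> P (h * p)%g.
  by rewrite inE; split=> /asboolP.
have gH : group_set H.
  apply/group_setP; split; first by apply/HP => p' Pp'; rewrite mul1g.
  move=> x y /HP xH /HP yH; apply/HP => p' Pp'; rewrite -mulgA.
  by apply: xH; exact: yH.
pose G := Group gH.
have adjG (i j : 'I_m) : j = i.+1 :> nat -> tperm i j \in G.
  by move=> ij; apply/HP => p'; exact: Padj.
have ltG k : forall i j : 'I_m, j = (i + k).+1 :> nat -> tperm i j \in G.
  elim: k => [|k IH] i j jik; first by apply: adjG; rewrite jik addn0.
  have km : ((i + k).+1 < m)%N by move: (ltn_ord j); rewrite jik; lia.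
  pose l := Ordinal km.
  have <- : (tperm i l ^ tperm l j)%g = tperm i j.
    by rewrite tpermJ tpermL tpermD//; apply/eqP => /(congr1 val) /=; lia.
  by apply: groupJ; [apply: IH|apply: adjG; rewrite /= jik; lia].
have [ts -> _] := prod_tpermP p.
suff /HP /(_ 1%g) : (\prod_(t <- ts) tperm t.1 t.2)%g \in G by rewrite mulg1; apply.
apply: group_prod => -[i j] _ /=.
have [ij|ji|/val_inj ->] := ltngtP i j; last by rewrite tperm1; exact: (group1 G).
  by apply: (ltG (j - i.+1)%N); lia.
by rewrite tpermC; apply: (ltG (i - j.+1)%N); lia.
Qed.

(** The solutions are the multiples of [q] to the number of inversions; the
    recursion alone is used, so that inversions need not be counted. *)
Definition mallows_weight (R : realType) (q : R) m (f : 'S_m -> R) :=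
  forall (i j : 'I_m) (p : 'S_m), j = i.+1 :> nat -> (p i < p j)%N ->
    f (tperm i j * p)%g = q * f p.

(** The ratio of [f p] to [f 1] depends only on [p] and [q]; it is kept as a
    common multiplier of [f 1] and [g 1], since these are not known to be
    nonzero. *)
Lemma mallows_weight_ratio (R : realType) (q : R) m (f g : 'S_m -> R) :
  0 < q -> mallows_weight q f -> mallows_weight q g ->
  forall p, exists c, f p = c * f 1%g /\ g p = c * g 1%g.
Proof.
move=> q0 fq gq; apply: perm_adjacent_ind; first by exists 1; rewrite !mul1r.
move=> i j p ij [c [fc gc]].
have [pij|pji] := ltnP (p i) (p j).
  by exists (q * c); rewrite fq// gq// fc gc !mulrA.
have pE : p = (tperm i j * (tperm i j * p))%g by rewrite mulgA tperm2 mul1g.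
have {}pji : ((tperm i j * p)%g i < (tperm i j * p)%g j)%N.
  rewrite !permM tpermL tpermR ltn_neqAle pji andbT; apply/eqP.
  by move=> /val_inj /perm_inj /(congr1 val) /=; lia.
have fE := fq _ _ _ ij pji; have gE := gq _ _ _ ij pji; rewrite -pE in fE gE.
exists (q^-1 * c); split; apply: (mulfI (lt0r_neq0 q0)).
  by rewrite -fE fc -mulrA mulVKf ?lt0r_neq0.
by rewrite -gE gc -mulrA mulVKf ?lt0r_neq0.
Qed.

Lemma mallows_weight_unique (R : realType) (q : R) m (f g : 'S_m -> R) :
  0 < q -> mallows_weight q f -> mallows_weight q g ->
  \sum_p f p = 1 -> \sum_p g p = 1 -> f =1 g.
Proof.
move=> q0 fq gq f1 g1.
have /choice[c cE] := mallows_weight_ratio q0 fq gq.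
have fc : (\sum_p c p) * f 1%g = 1.
  by rewrite mulr_suml -f1; apply: eq_bigr => p _; have [->] := cE p.
have gc : (\sum_p c p) * g 1%g = 1.
  by rewrite mulr_suml -g1; apply: eq_bigr => p _; have [_ ->] := cE p.
have c0 : \sum_p c p != 0.
  by apply/eqP => c0; move: fc; rewrite c0 mul0r => /eqP; rewrite eq_sym oner_eq0.
by move=> p; have [-> ->] := cE p; congr (_ * _); apply: (mulfI c0); rewrite fc.
Qed.

(** * Relative order of a permutation on a window *)

Lemma balperm_inj (s : balperm) : injective s.
Proof. exact: (bij_inj (permZ_bij s)). Qed.

Definition win n (i : 'I_n.*2) : int := i%:Z - n%:Z.

Lemma win_inj n : injective (@win n).
Proof. by move=> i j; rewrite /win => ij; apply/val_inj => /=; lia. Qed.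

Lemma in_windowP n k : in_window n k -> exists i, @win n i = k.
Proof.
rewrite /in_window => kn.
have jn : (absz (k + n%:Z)%R < n.*2)%N by lia.
by exists (Ordinal jn); rewrite /win /=; lia.
Qed.

Lemma win_in_window n (i : 'I_n.*2) : in_window n (win i).
Proof. by rewrite /in_window /win; have := ltn_ord i; lia. Qed.

Definition below n (f : int -> int) (m : int) :=
  [set j : 'I_n.*2 | f (win j) < m]%SET.

Lemma below_proper n (s : balperm) (i j : 'I_n.*2) :
  s (win i) < s (win j) ->
  (#|below n s (s (win i))| < #|below n s (s (win j))|)%N.
Proof.
move=> ij; apply: proper_card; apply/properP; split.
  by apply/fintype.subsetP => k; rewrite !inE => ki; exact: lt_trans ij.
by exists i; rewrite !inE ?ltxx.
Qed.

Lemma below_lt n (s : balperm) (i : 'I_n.*2) :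
  (#|below n s (s (win i))| < n.*2)%N.
Proof.
rewrite -[ltnRHS]card_ord; apply: proper_card; apply/properP; split.
  exact: subset_predT.
by exists i; rewrite !inE ?ltxx.
Qed.

Definition rank_ord n (s : balperm) (i : 'I_n.*2) : 'I_n.*2 :=
  Ordinal (below_lt s i).

Lemma rank_ord_inj n (s : balperm) : injective (@rank_ord n s).
Proof.
move=> i j /(congr1 val) /= ij.
have [sij|sji|/balperm_inj/win_inj//] := ltgtP (s (win i)) (s (win j)).
  by have := below_proper sij; rewrite ij ltnn.
by have := below_proper sji; rewrite ij ltnn.
Qed.

(** The relative order of the values on the window: position [i] is sent to the
    number of smaller values, the count that [below_eventually] evaluates. Its
    inverse is the permutation that sorts the values. *)
Definition rank n (s : balperm) : 'S_n.*2 := perm (@rank_ord_inj n s).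

Lemma rankE n (s : balperm) i : rank n s i = #|below n s (s (win i))| :> nat.
Proof. by rewrite permE. Qed.

Lemma rank_lt n (s : balperm) i j :
  (rank n s i < rank n s j)%N = (s (win i) < s (win j)).
Proof.
rewrite !rankE; have [ij|ji|ij] := ltgtP (s (win i)) (s (win j)).
- exact: below_proper.
- by apply/negbTE; rewrite -leqNgt ltnW// below_proper.
- by rewrite ij ltnn.
Qed.

Lemma eq_rank n (s t : balperm) :
  (forall i j : 'I_n.*2, (s (win i) < s (win j)) = (t (win i) < t (win j))) ->
  rank n s = rank n t.
Proof.
move=> st; apply/permP => i; apply/val_inj; rewrite /= !rankE.
by congr #|pred_of_set _|; apply/setP => j; rewrite !inE st.
Qed.

Lemma balperm_mulE (s t : balperm) k : (s * t : balperm)%g k = s (t k).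
Proof. by []. Qed.

Lemma adj_win n (i j k : 'I_n.*2) : j = i.+1 :> nat ->
  adj (win i) (win k) = win (tperm i j k).
Proof.
move=> ij; rewrite [LHS]/(adj_fun _ _) /adj_fun.
case: tpermP => [->|->|/eqP ki /eqP kj].
- by rewrite eqxx /win ij; lia.
- rewrite ifN; last by apply/eqP; rewrite /win ij; lia.
  by rewrite ifT//; apply/eqP; rewrite /win ij; lia.
- rewrite (inj_eq (@win_inj n)) (negbTE ki).
  rewrite (_ : win i + 1 = win j); last by rewrite /win ij; lia.
  by rewrite (inj_eq (@win_inj n)) (negbTE kj).
Qed.

(** Right multiplication permutes positions. The product of balanced
    permutations applies its right factor first, that of ['S_n] its left factor;
    hence the change of side. *)
Lemma rank_adj n (s : balperm) (i j : 'I_n.*2) : j = i.+1 :> nat ->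
  rank n (s * adj (win i))%g = (tperm i j * rank n s)%g.
Proof.
move=> ij; apply/permP => k; apply/val_inj; rewrite /= permM !rankE.
rewrite -[RHS](card_preimset _ (@perm_inj _ (tperm i j))).
congr #|pred_of_set _|; apply/setP => l.
by rewrite !inE !balperm_mulE !(adj_win _ ij).
Qed.

(** * Recovering a balanced permutation from its relative orders *)

Lemma cnt_window n (X : set int) : (forall k, X k -> in_window n k) ->
  cnt X = #|[set j : 'I_n.*2 | `[< X (win j) >]]%SET|.
Proof.
move=> Xn; set S := [set j | _]%SET.
have -> : X = [set` [fset win j | j in S]%fset].
  apply/seteqP; split=> k /=.
    move=> Xk; have [j jk] := in_windowP (Xn _ Xk); apply/imfsetP; exists j => //.
    by rewrite /= inE jk; apply/asboolP.
  by move=> /imfsetP[j /=]; rewrite inE => /asboolP Xj ->.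
by rewrite /cnt set_fsetK (card_imfset _ _ (@win_inj n)) /= -cardE.
Qed.

Lemma card_ord_le m k : (k <= m)%N -> #|[set i : 'I_m | (i < k)%N]%SET| = k.
Proof.
move=> km; rewrite -sum1dep_card big_ord_narrow//.
by rewrite sum1_card card_ord.
Qed.

Lemma finite_in_window (X : set int) : finite_set X ->
  exists N, forall n k, (N <= n)%N -> X k -> in_window n k.
Proof.
move=> finX; exists (\max_(k <- fset_set X) absz k)%N.+1 => n k Nn Xk.
have := @leq_bigmax_seq _ (enum_fset (fset_set X)) predT absz k.
rewrite in_fset_set// mem_set// => /(_ isT isT).
by rewrite /in_window; move: Nn; move: (\max_(_ <- _ | _) _)%N => M; lia.
Qed.

(** This is where balancedness enters: within a window that contains all
    positions crossing 0, as many nonpositive values sit at positive positions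
    as positive values sit at nonpositive positions, so there are as many
    nonpositive values as nonpositive positions. *)
Lemma below1_eventually (s : balperm) :
  exists N, forall n, (N <= n)%N -> #|below n s 1| = n.+1.
Proof.
have [finA AB] : balanced s by exact: set_mem (valP s).
have finB : finite_set [set j | j <= 0 /\ 1 <= s j].
  by rewrite -(eq_finite_set AB).
move/fcard_eq : AB => /(_ finA finB); rewrite -!/(cnt _) => AB.
have [N1 AN] := finite_in_window finA; have [N2 BN] := finite_in_window finB.
exists (N1 + N2).+1 => n nN.
move: AB; rewrite (@cnt_window n); last by move=> k; apply: AN; lia.
rewrite (@cnt_window n); last by move=> k; apply: BN; lia.
set A1 := [set _ | _]%SET; set B1 := [set _ | _]%SET => AB.
(* [L] consists of the nonpositive positions, of which there are [n + 1]. *)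
pose L := [set j : 'I_n.*2 | (j < n.+1)%N]%SET.
have cL : #|L| = n.+1 by rewrite card_ord_le//; lia.
rewrite -cL -(cardsID L (below n s 1)) -(cardsID (below n s 1) L) finset.setIC.
congr (_ + _)%N.
have -> : (below n s 1 :\: L)%SET = A1.
  apply/setP => j; rewrite !inE; apply/idP/asboolP; rewrite /win /=; last by lia.
  by case/andP => ? ?; split; lia.
have -> : (L :\: below n s 1)%SET = B1.
  apply/setP => j; rewrite !inE; apply/idP/asboolP; rewrite /win /=; last by lia.
  by case/andP => ? ?; split; lia.
by [].
Qed.

Lemma below_succ n (s : balperm) m : in_window n ((s^-1%g : balperm) m) ->
  #|below n s (m + 1)| = #|below n s m|.+1.
Proof.
move=> /in_windowP[i im]; have {}im : s (win i) = m by apply/balperm_invE.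
rewrite (_ : below n s (m + 1) = i |: below n s m)%SET.
  by rewrite cardsU1 inE im ltxx.
apply/setP => j; rewrite !inE; have [->|ji] := eqVneq j i; first by rewrite im /=; lia.
have : s (win j) != m.
  by rewrite -im; apply: contra_neq ji => /balperm_inj/win_inj.
by rewrite /=; lia.
Qed.

(** Moving the threshold from [m] to [m + 1] adds the single position
    [s^-1 m], which lies in every large window; so the count for threshold 1
    gives all others by induction in both directions. *)
Lemma below_eventually (s : balperm) m :
  exists N, forall n, (N <= n)%N -> #|below n s m|%:Z = m + n%:Z.
Proof.
have [N1 N1E] := below1_eventually s.
have sw k : exists N, forall n, (N <= n)%N -> in_window n ((s^-1%g : balperm) k).
  by have [N NE] := finite_in_window (finite_set1 ((s^-1%g : balperm) k));
    exists N => n Nn; exact: NE.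
have up (k : nat) : exists N, forall n, (N <= n)%N ->
    #|below n s (1 + k%:Z)|%:Z = 1 + k%:Z + n%:Z.
  elim: k => [|k [N IH]]; first by exists N1 => n nN; rewrite addr0 N1E//; lia.
  have [N' N'E] := sw (1 + k%:Z); exists (N + N')%N => n nN.
  rewrite (_ : 1 + k.+1%:Z = (1 + k%:Z) + 1); last by lia.
  by rewrite below_succ; [have := IH n; lia | apply: N'E; lia].
have down (k : nat) : exists N, forall n, (N <= n)%N ->
    #|below n s (1 - k%:Z)|%:Z = 1 - k%:Z + n%:Z.
  elim: k => [|k [N IH]]; first by exists N1 => n nN; rewrite subr0 N1E//; lia.
  have [N' N'E] := sw (1 - k.+1%:Z); exists (N + N')%N => n nN.
  have := @below_succ n s (1 - k.+1%:Z).
  rewrite (_ : 1 - k.+1%:Z + 1 = 1 - k%:Z); last by lia.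
  by rewrite N'E; last lia; move=> /(_ isT); have := IH n; lia.
have [m1|m1] := leP 1 m.
  by have := up (absz (m - 1)); rewrite (_ : 1 + _ = m)//; lia.
by have := down (absz (m - 1)); rewrite (_ : 1 - _ = m)//; lia.
Qed.

(** * Order events generate the Borel sigma-algebra *)

Definition order_event n (A : set balperm) :=
  forall s t : balperm, rank n s = rank n t -> A s -> A t.

Definition order_events : set (set balperm) :=
  [set A | exists n, order_event n A].

Lemma rank_mono m n (s t : balperm) : (m <= n)%N ->
  rank n s = rank n t -> rank m s = rank m t.
Proof.
move=> mn st; apply: eq_rank => i j.
have [i' <-] := in_windowP (in_window_le mn (win_in_window i)).
have [j' <-] := in_windowP (in_window_le mn (win_in_window j)).
by rewrite -!rank_lt st.
Qed.

Lemma order_event_mono m n A : (m <= n)%N -> order_event m A -> order_event n A.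
Proof. by move=> mn Am s t /(rank_mono mn); exact: Am. Qed.

Lemma order_events_setI : setI_closed order_events.
Proof.
move=> A B [m mA] [n nB]; exists (maxn m n).
have {}mA := order_event_mono (leq_maxl m n) mA.
have {}nB := order_event_mono (leq_maxr m n) nB.
by move=> s t st [As Bs]; split; [exact: mA As|exact: nB Bs].
Qed.

Lemma order_events_open : order_events `<=` open.
Proof.
move=> A [n An]; apply: (@determined_open n) => s t st; apply: An.
by apply: eq_rank => i j; rewrite !st// win_in_window.
Qed.

Lemma order_events_measurable : order_events `<=` measurable.
Proof. by move=> A /order_events_open /measurable_balperm_open. Qed.

(* The balanced permutations with the sigma-algebra generated by the order
   events. *)
Local Notation order_space := (g_sigma_algebraType order_events).

Lemma order_event_measurable n A : order_event n A ->
  measurable (A : set order_space).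
Proof. by move=> An; apply: sub_sigma_algebra; exists n. Qed.

(** By [below_eventually], [s i = m] holds if and only if position [i] has rank
    [m + n] in all large windows. *)
Lemma eval_measurable i m :
  measurable ([set s | (s : balperm) i = m] : set order_space).
Proof.
(* The premise makes [D n] an order event also when [i] is outside the window. *)
pose D n := [set s : balperm |
  in_window n i -> #|below n s (s i)|%:Z = m + n%:Z].
rewrite (_ : [set s | _] = \bigcup_N \bigcap_(n in [set n | (N <= n)%N]) D n).
  apply: bigcupT_measurable => N.
  apply: bigcap_measurable; first by exists N => /=.
  move=> n _; apply: (@order_event_measurable n) => s t st Ds.
  rewrite /D /= => iw; have [j ji] := in_windowP iw.
  by rewrite -{1}ji -rankE -st rankE ji; exact: Ds.
apply/seteqP; split => [s /= sim|s [N _ sN]].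
  have [N NE] := below_eventually s m; exists N => // n /= Nn iw.
  by rewrite sim NE.
have [N' N'E] := below_eventually s (s i).
pose n := (N + N' + `|i|%N.+1)%N.
have Nn : (N <= n)%N by rewrite /n; lia.
have iw : in_window n i by rewrite /in_window /n; lia.
have := sN n Nn iw; rewrite N'E; last by rewrite /n; lia.
by rewrite /=; lia.
Qed.

(** An open set is the union of the cylinders which it contains, and there are
    countably many cylinders. *)
Lemma open_order_measurable (U : set balperm) : open U ->
  measurable (U : set order_space).
Proof.
move=> oU.
pose cyl n (f : {ffun 'I_n.*2 -> int}) :=
  [set s : balperm | forall j, s (win j) = f j].
rewrite (_ : U = \bigcup_n
    \bigcup_(f in [set f | @cyl n f `<=` U]) cyl n f).
  apply: bigcupT_measurable => n; rewrite bigcup_mkcond.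
  apply: countable_bigcupT_measurable; first exact: countableP.
  move=> f; case: ifPn => // _.
  rewrite (_ : cyl n f = \bigcap_(j in setT) [set s | s (win j) = f j]).
    by apply: fin_bigcap_measurable => // j _; exact: eval_measurable.
  by apply/seteqP; split => s /= H j; [move=> _|]; exact: H.
apply/seteqP; split => [s Us|s [n _ [f fU]]]; last exact: fU.
have [n nU] := nbhs_agree (open_nbhs_nbhs (conj oU Us)).
exists n => //; exists [ffun j => s (win j)] => /=; last by move=> j; rewrite ffunE.
move=> t tf; apply: nU => k /in_windowP[j <-].
by rewrite tf ffunE.
Qed.

Lemma measurable_order_events : measurable = <<s order_events >>.
Proof.
apply/seteqP; split.
  apply: smallest_sub; first exact: smallest_sigma_algebra.
  by move=> U /open_order_measurable.
apply: smallest_sub; first exact: sigma_algebra_measurable.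
exact: order_events_measurable.
Qed.

(** * Uniqueness of right exchangeable measures *)

(** Named so that it can carry the structure of a measurable function, from
    which its distribution inherits that of a probability measure. *)
Definition balperm_inv (s : balperm) : balperm := s^-1%g.

Lemma balperm_inv_measurable : measurable_fun [set: balperm] balperm_inv.
Proof.
apply: (@measurability _ _ _ _ _ _ (@open balperm)) => // _ [U oU <-].
rewrite setTI; apply: measurable_balperm_open.
by apply: open_comp => // s _; exact: inv_continuous.
Qed.

HB.instance Definition _ :=
  isMeasurableFun.Build _ _ _ _ balperm_inv balperm_inv_measurable.

Lemma adj_adj i : (adj i * adj i)%g = 1%g.
Proof. by apply/val_inj/permZP => k; exact: adj_funK. Qed.

Lemma adjV i : ((adj i)^-1 = adj i)%g.
Proof. by rewrite -[LHS]mulg1 -(adj_adj i) mulKg. Qed.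

Lemma rank_event_measurable n p : measurable [set s | rank n s = p].
Proof.
by apply: order_events_measurable; exists n => s t /= ->.
Qed.

Section measures.
Context {R : realType}.
Implicit Types (q : R) (nu : {measure set balperm -> \bar R}).

(** The part of right exchangeability that the argument needs: on events in
    which position [i] is an ascent the density is the constant [q], and the
    integral disappears. Descents are ascents after the swap. *)
Definition ascent_scaling q nu := forall i (A : set balperm), measurable A ->
  (forall s, A s -> s i < s (i + 1)) ->
  nu [set s | A (s * adj i)%g] = (q%:E * nu A)%E.

Lemma equivalent_density_cst (rho : set balperm -> \bar R) nu
    (f : balperm -> R) q A :
  equivalent_density rho nu f -> measurable A -> (forall s, A s -> f s = q) ->
  rho A = (q%:E * nu A)%E.
Proof.
move=> [_ _ _ rhoE] mA fq; rewrite rhoE// -integral_cst//.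
by apply: eq_integral => s /set_mem /fq ->.
Qed.

Lemma right_exchangeable_scaling q nu :
  right_exchangeable q nu -> ascent_scaling q nu.
Proof.
move=> nuq i A mA iA; apply: (equivalent_density_cst (nuq i)) => // s /iA ss.
by rewrite gtr0_sgz ?subr_gt0// expr1z.
Qed.

(** Since [(adj i * s)^-1 = s^-1 * adj i], inversion turns the left action into
    the right one. *)
Lemma left_exchangeable_scaling q (Q : probability balperm R) :
  left_exchangeable q Q -> ascent_scaling q (distribution Q balperm_inv).
Proof.
move=> Qq i A mA iA.
have mAV : measurable (balperm_inv @^-1` A).
  by rewrite -[X in measurable X]setTI; exact: balperm_inv_measurable.
change (Q [set s | A ((balperm_inv s) * adj i)%g] =
  (q%:E * Q (balperm_inv @^-1` A))%E).
rewrite -(equivalent_density_cst (Qq i) mAV); last first.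
  by move=> s /iA ss; rewrite gtr0_sgz ?subr_gt0// expr1z.
rewrite /pushforward; congr (Q _); apply/seteqP; split=> s /=; rewrite /balperm_inv invMg.
all: by rewrite adjV.
Qed.

Lemma rank_law_weight q (nu : probability balperm R) n : ascent_scaling q nu ->
  mallows_weight q (fun p => fine (nu [set s | rank n s = p])).
Proof.
move=> nuq i j p ij pij.
have := nuq (win i) _ (@rank_event_measurable n p).
have wij : win i + 1 = win j by rewrite /win ij; lia.
have asc (s : balperm) : rank n s = p -> s (win i) < s (win j).
  by move=> sp; rewrite -rank_lt sp.
rewrite wij => nup.
have {}nup := nup (fun s sp => asc s sp).
rewrite (_ : [set s | rank n s = (tperm i j * p)%g] =
    [set s | [set s | rank n s = p] (s * adj (win i))%g]).
  rewrite nup fineM ?fin_num_measure//; exact: rank_event_measurable.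
apply/seteqP; split=> s /=; rewrite (rank_adj s ij).
  by move=> ->; rewrite mulgA tperm2 mul1g.
by move=> <-; rewrite mulgA tperm2 mul1g.
Qed.

Lemma rank_law_sum nu n (A : set balperm) : measurable A ->
  nu A = (\sum_p nu (A `&` [set s | rank n s = p]))%E.
Proof.
move=> mA.
have {1}-> : A = \bigcup_(p in [set` index_enum {perm 'I_n.*2}])
    (A `&` [set s | rank n s = p]).
  apply/seteqP; split=> [s As|s [p _ []]//].
  by exists (rank n s); rewrite //= mem_index_enum.
rewrite measure_fin_bigcup//.
- by rewrite -fsbig_seq// index_enum_uniq.
- by move=> p p' _ _ [s [[_ <-] [_ <-]]].
- by move=> p _; apply: measurableI => //; exact: rank_event_measurable.
Qed.

(** The laws of all [rank n] agree by [mallows_weight_unique], hence so do the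
    measures of order events, which are disjoint unions of events
    [rank n s = p]; these determine the measure. *)
Lemma ascent_scaling_unique q (mu nu : probability balperm R) : 0 < q ->
  ascent_scaling q mu -> ascent_scaling q nu ->
  forall A, measurable A -> mu A = nu A.
Proof.
move=> q0 muq nuq.
have sum1 (rho : probability balperm R) n :
    \sum_(p : 'S_n.*2) fine (rho [set s | rank n s = p]) = 1.
  apply: EFin_inj; rewrite -(probability_setT rho) (rank_law_sum rho n measurableT).
  rewrite -EFin_sum_fine => [|p _]; last first.
    by apply: fin_num_measure; rewrite setTI; exact: rank_event_measurable.
  by congr EFin; apply: eq_bigr => p _; rewrite setTI.
have rank_law n (p : 'S_n.*2) :
    mu [set s | rank n s = p] = nu [set s | rank n s = p].
  have mp := @rank_event_measurable n p.
  rewrite -[LHS]fineK ?fin_num_measure// -[RHS]fineK ?fin_num_measure//.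
  congr EFin; exact: (mallows_weight_unique q0 (@rank_law_weight _ mu n muq)
    (@rank_law_weight _ nu n nuq) (sum1 mu n) (sum1 nu n)).
apply: (measure_unique order_events (fun=> setT)).
- exact: measurable_order_events.
- exact: order_events_setI.
- by move=> _; exists 0%N.
- by rewrite bigcup_const//; exists 0%N.
- move=> A oA; have mA := order_events_measurable oA.
  have [n An] := oA; rewrite (rank_law_sum mu n mA) (rank_law_sum nu n mA).
  apply: eq_bigr => p _.
  have [[t [At tp]]|noA] := pselect (exists t, A t /\ rank n t = p).
    have -> : A `&` [set s | rank n s = p] = [set s | rank n s = p];
      last exact: rank_law.
    apply/seteqP; split => [s []//|s sp]; split=> //.
    by apply: An At; rewrite tp sp.
  rewrite (_ : A `&` _ = set0) ?measure0//.
  by rewrite -subset0 => s [As sp]; apply: noA; exists s.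
- by move=> _; apply: fin_num_fun_lty; exact: fin_num_measure.
Qed.

End measures.

Theorem corollary3p4 (R : realType) (q : R) (hq0 : 0 < q) (hq1 : q < 1)
    (Q : probability balperm R) (hQ : mallows q Q)
    (A : set balperm) (hA : measurable A) :
  pushforward Q (fun s : balperm => (s^-1)%g) A = Q A.
Proof.
have [Qr Ql] := hQ.
exact: (@ascent_scaling_unique _ q (distribution Q balperm_inv) Q hq0
  (left_exchangeable_scaling Ql) (right_exchangeable_scaling Qr) A hA).
Qed.
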